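(* Let $\gamma_k=\|A-P_{k+1}B_kQ_k^T\|$ and let $\alpha_k$, $\beta_k$, $\eta_k$ be as defined in the context. Then $$\alpha_{k+1}<\gamma_k\leq\sqrt{1+\eta_k^2}\,\sigma_{k+1},\qquad k=1,2,\ldots,n-1,$$ $$\beta_{k+2}<\gamma_k\leq\sqrt{1+\eta_k^2}\,\sigma_{k+1},\qquad k=1,2,\ldots,n-1,$$ $$\alpha_{k+1}\beta_{k+2}\leq\frac{\gamma_k^2}{2}\leq\frac{(1+\eta_k^2)\sigma_{k+1}^2}{2},\qquad k=1,2,\ldots,n-1,$$ $$\gamma_{k+1}<\gamma_k,\qquad k=1,2,\ldots,n-2.$$
   Context: $\|\cdot\|$ is the 2-norm (spectral norm for matrices). $A\in\mathbb{R}^{m\times n}$, $m\geq n$, has the SVD $A=U\begin{pmatrix}\Sigma\\ \mathbf 0\end{pmatrix}V^T$ with $U=(u_1,\ldots,u_m)$, $V=(v_1,\ldots,v_n)$ orthogonal, $\Sigma=\mathrm{diag}(\sigma_1,\ldots,\sigma_n)$, and simple singular values $\sigma_1>\cdots>\sigma_n>0$; $\Sigma_k=\mathrm{diag}(\sigma_1,\ldots,\sigma_k)$. The vector $b\in\mathbb{R}^m$ satisfies $u_i^Tb\neq0$ for $i=1,\ldots,n$. Lanczos bidiagonalization: starting from $b$, put $\beta_1p_1=b$, $\alpha_1q_1=A^Tp_1$, and for $i\geq1$, $\beta_{i+1}p_{i+1}=Aq_i-\alpha_ip_i$, $\alpha_{i+1}q_{i+1}=A^Tp_{i+1}-\beta_{i+1}q_i$,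 with $\alpha_i,\beta_i$ normalizing $q_i,p_i$ to unit length. With $P_{k+1}=(p_1,\ldots,p_{k+1})$ and $Q_k=(q_1,\ldots,q_k)$, both have orthonormal columns and $AQ_k=P_{k+1}B_k$, where $B_k\in\mathbb{R}^{(k+1)\times k}$ is lower bidiagonal with diagonal $\alpha_1,\ldots,\alpha_k$ and subdiagonal $\beta_2,\ldots,\beta_{k+1}$. Standing assumption: the process runs to completion without breakdown, producing $P_{n+1}$, $Q_n$ and $B_n\in\mathbb{R}^{(n+1)\times n}$ with $P^TAQ_n=\begin{pmatrix}B_n\\ \mathbf 0\end{pmatrix}$, where $P=(P_{n+1},\hat P)\in\mathbb{R}^{m\times m}$ and $Q_n\in\mathbb{R}^{n\times n}$ are orthogonal and all diagonals $\alpha_i>0$ and subdiagonals $\beta_{i+1}>0$, $i=1,\ldots,n$. Definition of $\Delta_k$ ($1\leq k\leq n-1$): let $D=\mathrm{diag}(\sigma_ju_j^Tb)_{j=1}^n$ and let $T_k\in\mathbb{R}^{n\times k}$ be the matrix whose $j$-th row is $(1,\sigma_j^2,\ldots,\sigma_j^{2k-2})$. Partition $D=\mathrm{diag}(D_1,D_2)$ and $T_k=\begin{pmatrix} T_{k1} \\ T_{k2} \end{pmatrix}$ with $D_1,T_{k1}\in\mathbb{R}^{k\times k}$. Then $\Delta_k=D_2T_{k2}T_{k1}^{-1}D_1^{-1}\in\mathbb{R}^{(n-k)\times k}$. Definition of $\eta_k$: $\eta_k=\epsilon_k/\sigma_{k+1}$ with $\epsilon_k\geq0$ given by $\epsilon_k^2=\|\Sigma_k(I+\Delta_k^T\Delta_k)^{-1}\Delta_k^T\Delta_k\|^2+\|\Sigma_k(I+\Delta_k^T\Delta_k)^{-1}\Delta_k^T\|^2$.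 *)

(* Defs.v *)
From HB Require Import structures.
From mathcomp Require Import all_boot all_order all_algebra.
From mathcomp Require Import classical_sets reals.

Set Implicit Arguments.
Unset Strict Implicit.
Unset Printing Implicit Defensive.

Import Order.TTheory GRing.Theory Num.Theory.
Local Open Scope ring_scope.

(* All sequences (singular values sigma, singular vectors u and v, Lanczos
   scalars alpha and beta, Lanczos vectors p and q) are functions on nat read
   with indices starting at 1; index 0 and indices beyond the relevant range
   carry no meaning. *)

Section Norms.
Variable R : realType.

Definition norm2 (n : nat) (x : 'cV[R]_n) : R :=
  Num.sqrt (\sum_(i < n) x i 0 ^+ 2).

Definition specnorm (m n : nat) (A : 'M[R]_(m, n)) : R :=
  sup [set norm2 (A *m x) | x in [set x : 'cV[R]_n | norm2 x <= 1]]%classic.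

End Norms.

Section Definitions.
Variable R : realType.

(* (x_1, ..., x_N) *)
Definition cols (d N : nat) (x : nat -> 'cV[R]_d) : 'M[R]_(d, N) :=
  \matrix_(i, j) x j.+1 i 0.

Definition orthogonal_mx (n : nat) (Q : 'M[R]_n) : Prop := Q^T *m Q = 1%:M.

Definition is_svd (m n : nat) (A : 'M[R]_(m, n)) (u : nat -> 'cV[R]_m)
    (sigma : nat -> R) (v : nat -> 'cV[R]_n) : Prop :=
  [/\ orthogonal_mx (cols m u), orthogonal_mx (cols n v)
    & A = cols m u
          *m (\matrix_(i < m, j < n) (sigma j.+1 *+ (i == j :> nat)))
          *m (cols n v)^T].

Definition simple_positive (n : nat) (sigma : nat -> R) : Prop :=
  (forall i, (1 <= i < n)%N -> sigma i.+1 < sigma i)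
  /\ (forall i, (1 <= i <= n)%N -> 0 < sigma i).

Definition dotc (m : nat) (x y : 'cV[R]_m) : R := (x^T *m y) 0 0.

(* Lanczos bidiagonalization of A started from b, run to completion (p_{n+1}
   and q_n are reached) without breakdown.  Orthonormality of the p_i and of
   the q_i is a consequence of the recurrences and is not assumed. *)
Record lanczos_bidiag (m n : nat) (A : 'M[R]_(m, n)) (b : 'cV[R]_m)
    (alpha beta : nat -> R) (p : nat -> 'cV[R]_m) (q : nat -> 'cV[R]_n)
    : Prop := LanczosBidiag {
  lanczos_p1 : beta 1 *: p 1 = b;
  lanczos_q1 : alpha 1 *: q 1 = A^T *m p 1;
  lanczos_p : forall i, (1 <= i <= n)%N ->
    beta i.+1 *: p i.+1 = A *m q i - alpha i *: p i;
  lanczos_q : forall i, (1 <= i < n)%N ->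
    alpha i.+1 *: q i.+1 = A^T *m p i.+1 - beta i.+1 *: q i;
  lanczos_p_unit : forall i, (1 <= i <= n.+1)%N -> norm2 (p i) = 1;
  lanczos_q_unit : forall i, (1 <= i <= n)%N -> norm2 (q i) = 1;
  lanczos_alpha_gt0 : forall i, (1 <= i <= n)%N -> 0 < alpha i;
  lanczos_beta_gt0 : forall i, (1 <= i <= n.+1)%N -> 0 < beta i }.

Definition Bmx (alpha beta : nat -> R) (k : nat) : 'M[R]_(k.+1, k) :=
  \matrix_(i, j) (alpha j.+1 *+ (i == j :> nat) + beta j.+2 *+ (i == j.+1 :> nat)).

Definition gammak (m n : nat) (A : 'M[R]_(m, n)) (alpha beta : nat -> R)
    (p : nat -> 'cV[R]_m) (q : nat -> 'cV[R]_n) (k : nat) : R :=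
  specnorm (A - cols k.+1 p *m Bmx alpha beta k *m (cols k q)^T).

(* diag(d_{s+1}, ..., d_{s+N}): the diagonal block of diag(d_1, d_2, ...) of
   size N located after the first s entries *)
Definition diag_block (d : nat -> R) (s N : nat) : 'M[R]_N :=
  diag_mx (\row_(j < N) d (s + j)%N.+1).

(* rows s+1, ..., s+N of T_k *)
Definition T_block (sigma : nat -> R) (k s N : nat) : 'M[R]_(N, k) :=
  \matrix_(i, j) (sigma (s + i)%N.+1 ^+ (2 * j)%N).

Definition Delta (m n : nat) (sigma : nat -> R) (u : nat -> 'cV[R]_m)
    (b : 'cV[R]_m) (k : nat) : 'M[R]_(n - k, k) :=
  let d j := sigma j * dotc (u j) b in
  let D1 := diag_block d 0 k in
  let D2 := diag_block d k (n - k) in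
  let Tk1 := T_block sigma k 0 k in
  let Tk2 := T_block sigma k k (n - k) in
  D2 *m Tk2 *m invmx Tk1 *m invmx D1.

Definition epsilonk (m n : nat) (sigma : nat -> R) (u : nat -> 'cV[R]_m)
    (b : 'cV[R]_m) (k : nat) : R :=
  let Dk := Delta n sigma u b k in
  let Sk := diag_block sigma 0 k in
  let W := invmx (1%:M + Dk^T *m Dk) in
  Num.sqrt (specnorm (Sk *m W *m Dk^T *m Dk) ^+ 2
            + specnorm (Sk *m W *m Dk^T) ^+ 2).

Definition etak (m n : nat) (sigma : nat -> R) (u : nat -> 'cV[R]_m)
    (b : 'cV[R]_m) (k : nat) : R :=
  epsilonk n sigma u b k / sigma k.+1.

End Definitions.

(* Main.v *)
Require Import Defs.
From HB Require Import structures.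
From mathcomp Require Import all_boot all_order all_algebra.
From mathcomp Require Import classical_sets reals.
From mathcomp Require Import ring lra zify.

Set Implicit Arguments.
Unset Strict Implicit.
Unset Printing Implicit Defensive.

Import Order.TTheory GRing.Theory Num.Theory.
Local Open Scope ring_scope.

(* Since [A Q_k = P_{k+1} B_k], gamma_k is the norm of [A] on the orthogonal
   complement of [q_1, ..., q_k].  Testing on [q_{k+1}] gives
   [alpha_{k+1}^2 + beta_{k+2}^2 <= gamma_k^2].  If gamma_{k+1} were equal to
   gamma_k, a maximizer orthogonal to [q_1, ..., q_{k+1}] would be a top
   eigenvector of the compression of [A^T A] to the complement of
   [q_1, ..., q_k], hence orthogonal to every [q_j] because this compression is
   an unreduced tridiagonal matrix.  For the upper bound, a vector orthogonal to
   [q_1, ..., q_k] is orthogonal to the Krylov space of [A^T A] and [A^T b],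
   which ties its first [k] coordinates [y1] in the basis [v] to the others by
   [y1 = - Delta_k^T y2]; those contribute at most epsilon_k to the norm and the
   others at most sigma_{k+1}. *)

(** * Euclidean inner product, and Cauchy-Schwarz for semidefinite forms *)

Section InnerProduct.
Variable R : realType.

Lemma dotcE n (x y : 'cV[R]_n) : dotc x y = \sum_(i < n) x i 0 * y i 0.
Proof. by rewrite /dotc mxE; apply: eq_bigr => i _; rewrite mxE. Qed.

Lemma dotcC n (x y : 'cV[R]_n) : dotc x y = dotc y x.
Proof. by rewrite !dotcE; apply: eq_bigr => i _; rewrite mulrC. Qed.

Lemma dotcDr n (x y z : 'cV[R]_n) : dotc x (y + z) = dotc x y + dotc x z.
Proof. by rewrite /dotc mulmxDr mxE. Qed.

Lemma dotcZr n (x y : 'cV[R]_n) a : dotc x (a *: y) = a * dotc x y.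
Proof. by rewrite /dotc -scalemxAr mxE. Qed.

Lemma dotcBr n (x y z : 'cV[R]_n) : dotc x (y - z) = dotc x y - dotc x z.
Proof. by rewrite -scaleN1r dotcDr dotcZr mulN1r. Qed.

Lemma dotc0r n (x : 'cV[R]_n) : dotc x 0 = 0.
Proof. by rewrite /dotc mulmx0 mxE. Qed.

Lemma dotcDl n (x y z : 'cV[R]_n) : dotc (y + z) x = dotc y x + dotc z x.
Proof. by rewrite !(dotcC _ x) dotcDr. Qed.

Lemma dotcZl n (x y : 'cV[R]_n) a : dotc (a *: y) x = a * dotc y x.
Proof. by rewrite !(dotcC _ x) dotcZr. Qed.

Lemma dotc0l n (x : 'cV[R]_n) : dotc 0 x = 0.
Proof. by rewrite dotcC dotc0r. Qed.

Lemma dotc_mulmxl m n (A : 'M[R]_(m, n)) x y :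
  dotc (A *m x) y = dotc x (A^T *m y).
Proof. by rewrite /dotc trmx_mul mulmxA. Qed.

Lemma dotc_mulmxr m n (A : 'M[R]_(m, n)) x y :
  dotc y (A *m x) = dotc (A^T *m y) x.
Proof. by rewrite dotc_mulmxl trmxK. Qed.

Lemma dotcc_ge0 n (x : 'cV[R]_n) : 0 <= dotc x x.
Proof. by rewrite dotcE sumr_ge0 // => i _; rewrite -expr2 sqr_ge0. Qed.

Lemma dotcc_eq0 n (x : 'cV[R]_n) : dotc x x = 0 -> x = 0.
Proof.
rewrite dotcE => /eqP; rewrite psumr_eq0 => [|i _]; last by rewrite -expr2 sqr_ge0.
move/allP => x0; apply/matrixP => i j; rewrite ord1 mxE.
have := x0 i; rewrite mem_index_enum => /(_ isT).
by rewrite -expr2 sqrf_eq0 => /eqP.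
Qed.

Lemma norm2E n (x : 'cV[R]_n) : norm2 x = Num.sqrt (dotc x x).
Proof. by rewrite dotcE /norm2; under eq_bigr do rewrite expr2. Qed.

Lemma norm2_sqr n (x : 'cV[R]_n) : norm2 x ^+ 2 = dotc x x.
Proof. by rewrite norm2E sqr_sqrtr ?dotcc_ge0. Qed.

Lemma norm2_ge0 n (x : 'cV[R]_n) : 0 <= norm2 x.
Proof. exact: sqrtr_ge0. Qed.

Lemma norm2_eq0 n (x : 'cV[R]_n) : norm2 x = 0 -> x = 0.
Proof. by move=> x0; apply: dotcc_eq0; rewrite -norm2_sqr x0 expr0n. Qed.

Lemma norm20 n : norm2 (0 : 'cV[R]_n) = 0.
Proof. by rewrite norm2E dotc0r sqrtr0. Qed.

Lemma norm2Z n a (x : 'cV[R]_n) : norm2 (a *: x) = `|a| * norm2 x.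
Proof.
by rewrite !norm2E dotcZl dotcZr mulrA -expr2 sqrtrM ?sqr_ge0// sqrtr_sqr.
Qed.

Definition psd n (M : 'M[R]_n) : Prop :=
  M^T = M /\ forall x, 0 <= dotc x (M *m x).

(** Degenerate forms must be covered: [gammak_strict] applies this at a nonzero candidate [y] where
    the form vanishes, to conclude that [y] lies in its radical. *)
Lemma psd_CauchySchwarz n (M : 'M[R]_n) x y : psd M ->
  dotc x (M *m y) ^+ 2 <= dotc x (M *m x) * dotc y (M *m y).
Proof.
move=> [MT M0].
have quad s t : dotc (s *: x + t *: y) (M *m (s *: x + t *: y))
  = s ^+ 2 * dotc x (M *m x) + 2 * s * t * dotc x (M *m y)
    + t ^+ 2 * dotc y (M *m y).
  have yx : dotc y (M *m x) = dotc x (M *m y) by rewrite dotc_mulmxr MT dotcC.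
  rewrite mulmxDr -!scalemxAr !dotcDl !dotcDr !dotcZl !dotcZr yx; ring.
set a := dotc x (M *m x); set c := dotc x (M *m y); set d := dotc y (M *m y).
have [d0|d0] := eqVneq d 0; last first.
  have dgt : 0 < d by rewrite lt_def d0 M0.
  (* At [d x - c y] the form takes the value [d (a d - c ^+ 2)]. *)
  have := M0 (d *: x + (- c) *: y); rewrite quad -/a -/c -/d => h.
  have : 0 <= d * (a * d - c ^+ 2) by apply: le_trans h _; lra.
  by rewrite pmulr_rge0 // subr_ge0.
have [->|c0] := eqVneq c 0; first by rewrite d0 mulr0 expr0n.
(* With [d = 0] the form is affine in the coefficient of [y]; this coefficient makes it [-1], a
   contradiction. *)
have := M0 (1 *: x + (- (a + 1) / (2 * c)) *: y); rewrite quad -/a -/c -/d d0.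
have -> : 1 ^+ 2 * a + 2 * 1 * (- (a + 1) / (2 * c)) * c
  + (- (a + 1) / (2 * c)) ^+ 2 * 0 = -1 by field.
lra.
Qed.

Lemma psd1 n : psd (1%:M : 'M[R]_n).
Proof. by split=> [|x]; rewrite ?trmx1 // mul1mx dotcc_ge0. Qed.

Lemma CauchySchwarz n (x y : 'cV[R]_n) :
  dotc x y ^+ 2 <= dotc x x * dotc y y.
Proof. by have := psd_CauchySchwarz x y (psd1 n); rewrite !mul1mx. Qed.

Lemma CauchySchwarz_norm2 n (x y : 'cV[R]_n) : dotc x y <= norm2 x * norm2 y.
Proof.
apply: le_trans (ler_norm _) _.
rewrite -(@ler_pXn2r _ 2) ?nnegrE ?mulr_ge0 ?norm2_ge0 //.
by rewrite real_normK ?num_real // exprMn !norm2_sqr CauchySchwarz.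
Qed.

Lemma ler_norm2D n (x y : 'cV[R]_n) : norm2 (x + y) <= norm2 x + norm2 y.
Proof.
rewrite -(@ler_pXn2r _ 2) ?nnegrE ?addr_ge0 ?norm2_ge0 //.
rewrite norm2_sqr dotcDl !dotcDr (dotcC y) sqrrD !norm2_sqr.
have := CauchySchwarz_norm2 x y; lra.
Qed.

Lemma norm2N n (x : 'cV[R]_n) : norm2 (- x) = norm2 x.
Proof. by rewrite -scaleN1r norm2Z normrN1 mul1r. Qed.

End InnerProduct.

(** * The spectral norm as a supremum over the unit ball *)

Section SpectralNorm.
Variable R : realType.

(** Cauchy-Schwarz on each row shows that the Frobenius norm works. This makes the [sup] in
    [specnorm] a true supremum. *)
Lemma mulmx_bounded m n (A : 'M[R]_(m, n)) :
  exists2 c, 0 <= c & forall x, norm2 (A *m x) <= c * norm2 x.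
Proof.
pose f : R := \sum_i dotc (row i A)^T (row i A)^T.
have f0 : 0 <= f by apply: sumr_ge0 => i _; exact: dotcc_ge0.
exists (Num.sqrt f); first exact: sqrtr_ge0.
move=> x; rewrite !norm2E -sqrtrM // ler_wsqrtr // dotcE mulr_suml.
apply: ler_sum => i _; rewrite -expr2.
suff -> : (A *m x) i 0 = dotc (row i A)^T x by exact: CauchySchwarz.
by rewrite /dotc trmxK -row_mul [RHS]mxE.
Qed.

Lemma specnorm_has_sup m n (A : 'M[R]_(m, n)) :
  has_sup [set norm2 (A *m x) | x in [set x : 'cV[R]_n | norm2 x <= 1]]%classic.
Proof.
split; first by exists (norm2 (A *m 0)), 0 => //=; rewrite norm20.
have [c c0 Ac] := mulmx_bounded A; exists c => _ [x /= x1 <-].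
by apply: le_trans (Ac x) _; rewrite ler_piMr.
Qed.

Lemma specnorm_le m n (A : 'M[R]_(m, n)) c : 0 <= c ->
  (forall x, norm2 (A *m x) <= c * norm2 x) -> specnorm A <= c.
Proof.
move=> c0 Ac; apply: ge_sup; first by case: (specnorm_has_sup A).
by move=> _ [x /= x1 <-]; apply: le_trans (Ac x) _; rewrite ler_piMr.
Qed.

Lemma specnorm_ge0 m n (A : 'M[R]_(m, n)) : 0 <= specnorm A.
Proof.
apply: ub_le_sup; first by case: (specnorm_has_sup A).
by exists 0; rewrite /= ?mulmx0 norm20.
Qed.

Lemma norm2_mulmx_le m n (A : 'M[R]_(m, n)) x :
  norm2 (A *m x) <= specnorm A * norm2 x.
Proof.
have [/norm2_eq0 ->|x0] := eqVneq (norm2 x) 0.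
  by rewrite mulmx0 !norm20 mulr0.
have xgt : 0 < norm2 x by rewrite lt_def x0 norm2_ge0.
rewrite -ler_pdivrMr //; apply: ub_le_sup.
  by case: (specnorm_has_sup A).
exists ((norm2 x)^-1 *: x) => /=.
  by rewrite norm2Z ger0_norm ?invr_ge0 ?norm2_ge0 // mulVf.
by rewrite -scalemxAr norm2Z ger0_norm ?invr_ge0 ?norm2_ge0 // mulrC.
Qed.

(* The Gram defect [c ^+ 2 - G^T G] is positive definite; pairing [x] with its
   preimage under it in Cauchy-Schwarz bounds it away from 0, so no
   compactness is needed to see that the supremum stays below [c]. *)
Lemma specnorm_lt m n (G : 'M[R]_(m, n)) (c : R) : 0 < c ->
  (forall x : 'cV_n, x != 0 -> norm2 (G *m x) < c * norm2 x) -> specnorm G < c.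
Proof.
move=> c0 Gc; pose M := (c ^+ 2)%:M - G^T *m G.
have formM (x : 'cV_n) : dotc x (M *m x) = (c * norm2 x) ^+ 2 - norm2 (G *m x) ^+ 2.
  rewrite mulmxBl mul_scalar_mx dotcBr dotcZr exprMn !norm2_sqr.
  by rewrite -mulmxA -dotc_mulmxl.
have psdM : psd M.
  split=> [|x].
    by rewrite linearB /= tr_scalar_mx trmx_mul trmxK.
  rewrite formM subr_ge0 ler_pXn2r ?nnegrE ?mulr_ge0 ?norm2_ge0 ?(ltW c0) //.
  by have [->|/Gc/ltW//] := eqVneq x 0; rewrite mulmx0 !norm20 mulr0.
have kerM (x : 'cV_n) : M *m x = 0 -> x = 0.
  have [->//|x0 Mx] := eqVneq x 0.
  have := Gc x x0; rewrite -(@ltr_pXn2r _ 2) ?nnegrE ?mulr_ge0 ?norm2_ge0 ?(ltW c0) //.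
  by rewrite -subr_gt0 -formM Mx dotc0r ltxx.
have unitM : M \in unitmx.
  rewrite -row_free_unit -kermx_eq0; apply/eqP/row_matrixP => i; rewrite row0.
  apply: trmx_inj; rewrite trmx0; apply: kerM; apply: trmx_inj.
  by case: psdM => MT _; rewrite trmx_mul trmxK MT -row_mul mulmx_ker row0 trmx0.
have [d d0 Md] := mulmx_bounded (invmx M).
(* Cauchy-Schwarz for [M], at [x] and its preimage, bounds the fourth power of the norm of [x] by
   the form at [x] times [d * norm2 x ^+ 2]. Using [d + 1] keeps the constant positive, so that it
   can be inverted in [e]. *)
have lower (x : 'cV_n) : norm2 x ^+ 2 <= (d + 1) * dotc x (M *m x).
  have [->|x0] := eqVneq x 0.
    by rewrite dotc0l norm20 expr0n mulr0.
  have xgt : 0 < norm2 x.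
    by rewrite lt_def norm2_ge0 andbT; apply: contraNneq x0 => /norm2_eq0->.
  have Mge : 0 <= dotc x (M *m x) by case: psdM.
  have := psd_CauchySchwarz x (invmx M *m x) psdM.
  rewrite mulKVmx // -!norm2_sqr => CS.
  have yx : dotc (invmx M *m x) x <= (d + 1) * norm2 x ^+ 2.
    apply: le_trans (CauchySchwarz_norm2 _ _) _; rewrite expr2 mulrA.
    apply: ler_wpM2r; first exact: norm2_ge0.
    apply: le_trans (Md x) _; apply: ler_wpM2r; first exact: norm2_ge0.
    by rewrite lerDl.
  have x2 : 0 < norm2 x ^+ 2 by rewrite exprn_gt0.
  rewrite -(ler_pM2r x2) -[X in X <= _]expr2.
  apply: le_trans CS _; rewrite mulrAC [_ * dotc x _]mulrC.
  exact: ler_wpM2l.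
pose e := c ^+ 2 - (d + 1)^-1.
have Ge (x : 'cV_n) : norm2 (G *m x) ^+ 2 <= e * norm2 x ^+ 2.
  have d1 : 0 < d + 1 by rewrite ltr_wpDl.
  have := lower x; rewrite formM mulrC -ler_pdivrMr // /e exprMn => h.
  by rewrite mulrBl (mulrC _^-1); lra.
(* For [n = 0] nothing forces [e] to be nonnegative, hence the maximum with 0. *)
have ee : Num.max 0 e < c ^+ 2.
  by rewrite gt_max exprn_gt0 //= /e ltrBlDr ltrDl invr_gt0 ltr_wpDl.
apply: (@le_lt_trans _ _ (Num.sqrt (Num.max 0 e))).
  apply: specnorm_le => [|x]; first exact: sqrtr_ge0.
  rewrite -(@ler_pXn2r _ 2) ?nnegrE ?mulr_ge0 ?norm2_ge0 ?sqrtr_ge0 //.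
  rewrite exprMn (@sqr_sqrtr _ (Num.max 0 e)) ?le_max ?lexx //.
  by apply: le_trans (Ge x) _; rewrite ler_wpM2r ?sqr_ge0 // le_max lexx orbT.
by rewrite -[ltRHS](ger0_norm (ltW c0)) -sqrtr_sqr ltr_sqrt ?exprn_gt0.
Qed.

End SpectralNorm.

(** * Orthonormal families, Parseval's identity and orthogonal projection *)

Section OrthonormalColumns.
Variable R : realType.

Lemma mulmx_trcols d N (x : nat -> 'cV[R]_d) y (i : 'I_N) :
  ((cols N x)^T *m y) i 0 = dotc (x i.+1) y.
Proof. by rewrite mxE dotcE; apply: eq_bigr => j _; rewrite !mxE. Qed.

Lemma trcols_mulmx_cols d N M (x y : nat -> 'cV[R]_d) (i : 'I_N) (j : 'I_M) :
  ((cols N x)^T *m cols M y) i j = dotc (x i.+1) (y j.+1).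
Proof. by rewrite mxE dotcE; apply: eq_bigr => r _; rewrite !mxE. Qed.

Lemma mulmx_cols d N (x : nat -> 'cV[R]_d) (y : 'cV[R]_N) :
  cols N x *m y = \sum_(i < N) y i 0 *: x i.+1.
Proof.
apply/matrixP => i j; rewrite ord1 mxE summxE.
by apply: eq_bigr => l _; rewrite !mxE mulrC.
Qed.

Lemma col_mulmx m n r (A : 'M[R]_(m, n)) (B : 'M_(n, r)) j :
  col j (A *m B) = A *m col j B.
Proof. by rewrite !colE mulmxA. Qed.

Lemma col_cols d N (x : nat -> 'cV[R]_d) (i : 'I_N) :
  col i (cols N x) = x i.+1.
Proof. by apply/matrixP => r c; rewrite ord1 !mxE. Qed.

Lemma dotc_orthogonal_cols N (x : nat -> 'cV[R]_N) i j :
  orthogonal_mx (cols N x) -> (1 <= i <= N)%N -> (1 <= j <= N)%N ->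
  dotc (x i) (x j) = (i == j)%:R.
Proof.
case: i j => [|i] [|j]; rewrite /orthogonal_mx //= => xO iN jN.
have := congr1 (fun M : 'M_N => M (Ordinal iN) (Ordinal jN)) xO.
by rewrite /= trcols_mulmx_cols [RHS]mxE -val_eqE /= eqSS.
Qed.

(** The matrix is square, so its transpose is also a right inverse: the orthonormal family is
    complete. *)
Lemma Parseval N (x : nat -> 'cV[R]_N) (y z : 'cV[R]_N) :
  orthogonal_mx (cols N x) ->
  dotc y z = \sum_(i < N) dotc (x i.+1) y * dotc (x i.+1) z.
Proof.
move=> /mulmx1C xO; rewrite -[z in LHS]mul1mx -xO -mulmxA dotc_mulmxr dotcE.
by apply: eq_bigr => i _; rewrite !mulmx_trcols.
Qed.

Lemma orthogonal_cols_eq0 N (x : nat -> 'cV[R]_N) (y : 'cV[R]_N) :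
  orthogonal_mx (cols N x) -> (forall i, (1 <= i <= N)%N -> dotc (x i) y = 0) ->
  y = 0.
Proof.
move=> xO y0; apply: dotcc_eq0; rewrite (Parseval _ _ xO) big1 // => i _.
by rewrite y0 ?mul0r //= ltn_ord.
Qed.

Section Projection.
Variables (d N : nat) (x : nat -> 'cV[R]_d).
Hypothesis xO : (cols N x)^T *m cols N x = 1%:M.

(** For orthonormal [x], the projector onto the orthogonal complement of the first [N] vectors. *)
Definition cproj : 'M[R]_d := 1%:M - cols N x *m (cols N x)^T.

Lemma dotc_cproj i y : (1 <= i <= N)%N -> dotc (x i) (cproj *m y) = 0.
Proof.
case: i => [|i] //= iN; rewrite -(mulmx_trcols _ _ (Ordinal iN)).
by rewrite mulmxA mulmxBr mulmx1 mulmxA xO mul1mx subrr mul0mx mxE.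
Qed.

Lemma cproj_id y :
  (forall i, (1 <= i <= N)%N -> dotc (x i) y = 0) -> cproj *m y = y.
Proof.
move=> y0; rewrite mulmxBl mul1mx -mulmxA mulmx_cols big1 ?subr0 // => i _.
by rewrite mulmx_trcols y0 ?scale0r //= ltn_ord.
Qed.

Lemma cproj_norm y : norm2 (cproj *m y) <= norm2 y.
Proof.
rewrite -(@ler_pXn2r _ 2) ?nnegrE ?norm2_ge0 // !norm2_sqr.
have -> : dotc (cproj *m y) (cproj *m y)
    = dotc y y - dotc ((cols N x)^T *m y) ((cols N x)^T *m y).
  (* The projector is symmetric and fixes its image, so the left side reduces to
     [dotc y (cproj *m y)]. *)
  rewrite dotc_mulmxl [cproj^T](_ : _ = cproj); last first.
    by rewrite /cproj linearB /= trmx1 trmx_mul trmxK.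
  rewrite cproj_id => [|i]; last exact: dotc_cproj.
  by rewrite mulmxBl mul1mx dotcBr -mulmxA [in RHS]dotc_mulmxl trmxK.
by rewrite gerBl dotcc_ge0.
Qed.

End Projection.
End OrthonormalColumns.

(** * Lanczos vectors, and gamma_k as the norm of a restriction of [A] *)

Section Lanczos.
Variables (R : realType) (m n : nat) (A : 'M[R]_(m, n)) (b : 'cV[R]_m).
Variables (alpha beta : nat -> R) (p : nat -> 'cV[R]_m) (q : nat -> 'cV[R]_n).
Hypothesis lan : lanczos_bidiag A b alpha beta p q.

Lemma mulmx_lanczos i : (1 <= i <= n)%N ->
  A *m q i = alpha i *: p i + beta i.+1 *: p i.+1.
Proof. by move=> iN; rewrite (lanczos_p lan iN) addrC subrK. Qed.

Lemma mulmx_tr_lanczos1 : A^T *m p 1 = alpha 1 *: q 1.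
Proof. by rewrite (lanczos_q1 lan). Qed.

Lemma mulmx_tr_lanczos i : (1 <= i < n)%N ->
  A^T *m p i.+1 = alpha i.+1 *: q i.+1 + beta i.+1 *: q i.
Proof. by move=> iN; rewrite (lanczos_q lan iN) subrK. Qed.

Lemma dotc_p_unit i : (1 <= i <= n.+1)%N -> dotc (p i) (p i) = 1.
Proof. by move=> iN; rewrite -norm2_sqr (lanczos_p_unit lan iN) expr1n. Qed.

Lemma dotc_q_unit i : (1 <= i <= n)%N -> dotc (q i) (q i) = 1.
Proof. by move=> iN; rewrite -norm2_sqr (lanczos_q_unit lan iN) expr1n. Qed.

(** Both families are handled in one induction, with [p] one index ahead of [q]: each new [q] is
    orthogonal to the old ones because of the [p] reached so far, and then the next [p] because of
    that [q]. Positive [alpha] and [beta] are cancelled from the recurrences. *)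
Lemma lanczos_orthogonal N : (N <= n)%N ->
  (forall i j, (1 <= i < j)%N -> (j <= N.+1)%N -> dotc (p i) (p j) = 0) /\
  (forall i j, (1 <= i < j)%N -> (j <= N)%N -> dotc (q i) (q j) = 0).
Proof.
elim: N => [|N IH] Nn; first by split=> i j; lia.
have [pO qO] := IH (ltnW Nn).
have qO' i j : (1 <= i < j)%N -> (j <= N.+1)%N -> dotc (q i) (q j) = 0.
  move=> ij; rewrite leq_eqVlt => /predU1P [jN|]; last exact: qO.
  case: N => [|N] in Nn pO qO jN IH *; first by lia.
  subst j; have a0 : alpha N.+2 != 0 by rewrite gt_eqF // (lanczos_alpha_gt0 lan).
  apply: (mulfI a0); rewrite mulr0 -dotcZr (lanczos_q lan); last by lia.
  rewrite dotcBr dotcZr -dotc_mulmxl mulmx_lanczos; last by lia.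
  rewrite dotcDl !dotcZl (pO i N.+2); [|lia..].
  (* For [i = N.+1] two terms [beta N.+2] cancel; for smaller [i] every term is zero. *)
  have [->|iN] := eqVneq i N.+1.
    by rewrite dotc_p_unit ?dotc_q_unit; [ring|lia..].
  by rewrite pO ?qO; [ring|lia..].
split; last exact: qO'.
move=> i j ij; rewrite leq_eqVlt => /predU1P [jN|]; last exact: pO.
subst j; have b0 : beta N.+2 != 0 by rewrite gt_eqF // (lanczos_beta_gt0 lan).
apply: (mulfI b0); rewrite mulr0 -dotcZr (lanczos_p lan); last by lia.
rewrite dotcBr dotcZr dotc_mulmxr.
(* [p 1] is treated apart, since its image under [A^T] has no [beta] term. *)
case: i => [|[|i]] in ij *; first by lia.
  rewrite mulmx_tr_lanczos1 dotcZl.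
  case: N => [|N] in Nn pO qO qO' b0 IH ij *.
    by rewrite dotc_q_unit ?dotc_p_unit; [ring|lia..].
  by rewrite qO' ?pO; [ring|lia..].
rewrite mulmx_tr_lanczos; last by lia.
rewrite dotcDl !dotcZl (qO' i.+1 N.+1); [|lia..].
(* If [i.+1 = N], two terms [alpha N.+1] cancel; otherwise every term is zero. *)
have [iN|iN] := eqVneq i.+1 N.
  by rewrite iN dotc_p_unit ?dotc_q_unit; [ring|lia..].
by rewrite pO ?qO'; [ring|lia..].
Qed.

Lemma dotc_lanczos_q i j : (1 <= i <= n)%N -> (1 <= j <= n)%N ->
  dotc (q i) (q j) = (i == j)%:R.
Proof.
move=> iN jN; have [_ qO] := lanczos_orthogonal (leqnn n).
have [ij|ij|->] := ltngtP i j; last by rewrite dotc_q_unit.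
- by rewrite qO //; lia.
- by rewrite dotcC qO //; lia.
Qed.

Lemma lanczos_cols_q k : (k <= n)%N -> (cols k q)^T *m cols k q = 1%:M.
Proof.
move=> kn; apply/matrixP => i j.
rewrite trcols_mulmx_cols dotc_lanczos_q ?mxE ?eqSS ?val_eqE //=;
  exact: leq_trans (ltn_ord _) kn.
Qed.

(** The recurrence for [p], read column by column, says [A Q_k = P_{k+1} B_k], so the residual is
    [A (I - Q_k Q_k^T)]. *)
Lemma gammakE k : (k <= n)%N ->
  gammak A alpha beta p q k = specnorm (A *m cproj k q).
Proof.
move=> kn; rewrite /gammak /cproj mulmxBr mulmx1 mulmxA.
suff -> : cols k.+1 p *m Bmx alpha beta k = A *m cols k q by [].
apply/trmx_inj/row_matrixP => j; rewrite -!tr_col; congr (_^T).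
rewrite !col_mulmx col_cols.
rewrite mulmx_lanczos; last by have := ltn_ord j; lia.
have jk : (j < k.+1)%N by have := ltn_ord j; lia.
have jk' : (j.+1 < k.+1)%N by have := ltn_ord j; lia.
(* Column [j] of the bidiagonal matrix is supported on rows [j] and [j.+1]. *)
rewrite mulmx_cols (bigD1 (Ordinal jk)) //= (bigD1 (Ordinal jk')) /=; last first.
  by rewrite -val_eqE /= eqn_leq ltnn.
rewrite big1 ?addr0 => [|i /andP [ij ij']].
  rewrite !mxE /= !eqxx (gtn_eqF (ltnSn j)) (ltn_eqF (ltnSn j)).
  by rewrite !mulr1n !mulr0n add0r addr0.
move: ij ij'; rewrite -!val_eqE /= => /negbTE ij /negbTE ij'.
by rewrite !mxE ij ij' addr0 scale0r.
Qed.

Lemma gammak_ge k x : (k <= n)%N ->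
  (forall i, (1 <= i <= k)%N -> dotc (q i) x = 0) ->
  norm2 (A *m x) <= gammak A alpha beta p q k * norm2 x.
Proof.
move=> kn x0; rewrite gammakE //; apply: le_trans (norm2_mulmx_le _ x).
by rewrite -mulmxA cproj_id.
Qed.

(** With [gammak_ge], this identifies gamma_k as the least constant bounding [A] on the complement
    of [q_1, ..., q_k]; the projector drops out because it does not increase norms. *)
Lemma gammak_le k c : (k <= n)%N -> 0 <= c ->
  (forall x, (forall i, (1 <= i <= k)%N -> dotc (q i) x = 0) ->
     norm2 (A *m x) <= c * norm2 x) ->
  gammak A alpha beta p q k <= c.
Proof.
move=> kn c0 Ac; rewrite gammakE //; apply: specnorm_le => // x.
rewrite -mulmxA; apply: le_trans (Ac _ _) _ => [i ik|].
  by apply: dotc_cproj ik; exact: lanczos_cols_q.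
by apply: (ler_wpM2l c0); apply: cproj_norm; exact: lanczos_cols_q.
Qed.

(** By Pythagoras for [p_{k+1}] and [p_{k+2}], the left side is the squared norm of [A q_{k+1}]. *)
Lemma gammak_lower k : (k < n)%N ->
  alpha k.+1 ^+ 2 + beta k.+2 ^+ 2 <= gammak A alpha beta p q k ^+ 2.
Proof.
move=> kn; have [pO qO] := lanczos_orthogonal (leqnn n).
have := @gammak_ge k (q k.+1) (ltnW kn).
rewrite (lanczos_q_unit lan) ?mulr1; last by lia.
have -> : alpha k.+1 ^+ 2 + beta k.+2 ^+ 2 = norm2 (A *m q k.+1) ^+ 2.
  rewrite norm2_sqr mulmx_lanczos; last by lia.
  rewrite !dotcDr !dotcDl !dotcZl !dotcZr (dotcC (p k.+2) (p k.+1)).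
  rewrite (pO k.+1 k.+2); [|lia..].
  by rewrite !dotc_p_unit; [ring|lia..].
move=> h; rewrite ler_pXn2r ?nnegrE ?norm2_ge0 ?specnorm_ge0 //.
by apply: h => i ik; apply: qO; lia.
Qed.

(* Vectors orthogonal to [q_1, ..., q_j] see only the superdiagonal entry of
   the unreduced tridiagonal matrix [Q^T A^T A Q] in its [j]-th column. *)
Lemma dotc_gram_lanczos j x : (1 <= j < n)%N ->
  (forall i, (1 <= i <= j)%N -> dotc (q i) x = 0) ->
  dotc (A *m q j) (A *m x) = beta j.+1 * alpha j.+1 * dotc (q j.+1) x.
Proof.
move=> jn x0; rewrite mulmx_lanczos; last by lia.
rewrite dotcDl !dotcZl !dotc_mulmxr.
have -> : dotc (A^T *m p j) x = 0.
  case: j => [|[|j]] in jn x0 *; first by lia.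
    by rewrite mulmx_tr_lanczos1 dotcZl x0 ?mulr0.
  rewrite mulmx_tr_lanczos; last by lia.
  by rewrite dotcDl !dotcZl !x0 ?mulr0 ?addr0; [|lia..].
rewrite mulmx_tr_lanczos // dotcDl !dotcZl (x0 j); last by lia.
ring.
Qed.

Lemma gammak_strict k : (k.+1 < n)%N ->
  gammak A alpha beta p q k.+1 < gammak A alpha beta p q k.
Proof.
move=> kn; set g := gammak A alpha beta p q k.
have kn1 : (k < n)%N by lia.
have g0 : 0 < g.
  have := gammak_lower kn1; rewrite -/g => h; rewrite lt_def specnorm_ge0 andbT.
  apply: contraTneq h => ->; rewrite expr0n /= -ltNge ltr_wpDr ?sqr_ge0 //.
  by rewrite exprn_gt0 // (lanczos_alpha_gt0 lan).
have Q1 := lanczos_cols_q (ltnW kn).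
rewrite gammakE 1?ltnW //; apply: specnorm_lt => // x x0.
set y := cproj k.+1 q *m x.
have y0 i : (1 <= i <= k.+1)%N -> dotc (q i) y = 0 by exact: (dotc_cproj Q1).
have Ay : norm2 (A *m y) <= g * norm2 y.
  by apply: gammak_ge => [|i ik]; [lia|apply: y0; lia].
have yx : g * norm2 y <= g * norm2 x by rewrite ler_pM2l // cproj_norm.
(* Only equality remains to be excluded. It forces both inequalities [Ay] and [yx] to be equalities,
   so [y] attains gamma_k. *)
rewrite -mulmxA -/y lt_def (le_trans Ay yx) andbT; apply: contra_neq x0 => eqAx.
have eqA : norm2 (A *m y) = g * norm2 y by apply/le_anti; rewrite Ay -eqAx yx.
suff yE : y = 0.
  move: eqAx; rewrite yE mulmx0 norm20 => /eqP; rewrite mulf_eq0 gt_eqF //=.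
  by move/eqP/norm2_eq0.
(* [y] minimizes the nonnegative form [g ^+ 2 |z|^2 - |A z|^2] on the
   complement of [q_1, ..., q_k], hence lies in its radical. *)
pose G := A *m cproj k q; pose M := (g ^+ 2)%:M - G^T *m G.
have formM z w : (forall i, (1 <= i <= k)%N -> dotc (q i) w = 0) ->
    (forall i, (1 <= i <= k)%N -> dotc (q i) z = 0) ->
    dotc z (M *m w) = g ^+ 2 * dotc z w - dotc (A *m z) (A *m w).
  move=> w0 z0; rewrite mulmxBl mul_scalar_mx dotcBr dotcZr -mulmxA -dotc_mulmxl.
  by rewrite -!mulmxA !cproj_id.
have psdM : psd M.
  split=> [|z]; first by rewrite linearB /= tr_scalar_mx trmx_mul trmxK.
  rewrite mulmxBl mul_scalar_mx dotcBr dotcZr -mulmxA -dotc_mulmxl.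
  rewrite -!norm2_sqr -exprMn subr_ge0.
  rewrite ler_pXn2r ?nnegrE ?mulr_ge0 ?norm2_ge0 ?(ltW g0) //.
  by rewrite /g gammakE ?(ltnW kn1) // norm2_mulmx_le.
have yk i : (1 <= i <= k)%N -> dotc (q i) y = 0 by move=> ik; apply: y0; lia.
have rad z : (forall i, (1 <= i <= k)%N -> dotc (q i) z = 0) ->
    dotc (A *m z) (A *m y) = g ^+ 2 * dotc z y.
  move=> z0; have := psd_CauchySchwarz z y psdM.
  rewrite [dotc y _]formM // -!norm2_sqr eqA exprMn subrr mulr0 => h.
  have : dotc z (M *m y) == 0 by rewrite -sqrf_eq0 eq_le h sqr_ge0.
  by rewrite formM // subr_eq0 => /eqP.
apply: (orthogonal_cols_eq0 (lanczos_cols_q (leqnn n))).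
(* Up to [k.+1] the claim is [y0]. Beyond that, [q_N] with [N > k] is an admissible test vector in
   [rad], and [dotc_gram_lanczos] turns orthogonality to [q_N] into orthogonality to [q_{N+1}]. *)
suff H N : (N <= n)%N -> forall i, (1 <= i <= N)%N -> dotc (q i) y = 0.
  by move=> i; apply: H.
elim: N => [|N IH] Nn i; first by lia.
have [|Nk] := leqP N k; first by move=> Nk iN; apply: y0; lia.
have yN := IH (ltnW Nn); move=> iN.
have [->|iN1] := eqVneq i N.+1; last by apply: yN; lia.
have Nlt : (1 <= N < n)%N by lia.
have := dotc_gram_lanczos Nlt yN.
rewrite rad => [|j jk]; last first.
  by rewrite dotc_lanczos_q; [rewrite ltn_eqF //; lia|lia..].
rewrite yN ?mulr0; last by lia.
move/esym/eqP; rewrite mulf_eq0 => /orP [|/eqP //].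
rewrite mulf_eq0 !gt_eqF //; first by apply: (lanczos_alpha_gt0 lan); lia.
by apply: (lanczos_beta_gt0 lan); lia.
Qed.

(** Each factor [A^T A] is moved onto [x], at the cost of one orthogonality relation: [A^T A q_j]
    involves only [q_{j-1}], [q_j] and [q_{j+1}], so [A^T A x] is still orthogonal to
    [q_1, ..., q_{k-1}]. The base case uses that [A^T b] is a multiple of [q_1]. *)
Lemma lanczos_krylov_orthogonal k x i : (k <= n)%N -> (i < k)%N ->
  (forall j, (1 <= j <= k)%N -> dotc (q j) x = 0) ->
  dotc x (iter i (fun w => A^T *m (A *m w)) (A^T *m b)) = 0.
Proof.
elim: i k x => [|i IH] k x kn ik x0.
  rewrite -(lanczos_p1 lan) -scalemxAr mulmx_tr_lanczos1 dotcC !dotcZl.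
  by rewrite x0 ?mulr0.
rewrite /= -dotc_mulmxl dotc_mulmxr.
apply: (IH k.-1); [lia..|] => j jk.
rewrite -dotc_mulmxl mulmx_lanczos; last by lia.
rewrite dotcDl !dotcZl !dotc_mulmxr (@mulmx_tr_lanczos j); last by lia.
case: j => [|[|j]] in jk *; first by lia.
  by rewrite mulmx_tr_lanczos1 dotcDl !dotcZl !x0; [ring|lia..].
rewrite mulmx_tr_lanczos; last by lia.
by rewrite !dotcDl !dotcZl !x0; [ring|lia..].
Qed.

End Lanczos.

(** * Coordinates in the right singular basis *)

Section SingularVectors.
Variables (R : realType) (m n : nat) (A : 'M[R]_(m, n)).
Variables (u : nat -> 'cV[R]_m) (sigma : nat -> R) (v : nat -> 'cV[R]_n).
Hypothesis (le_nm : (n <= m)%N) (svdA : is_svd A u sigma v).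

Lemma svd_mulmx j : (1 <= j <= n)%N -> A *m v j = sigma j *: u j.
Proof.
case: j => [|j] //= jn; have [_ vO ->] := svdA; rewrite -mulmxA.
have -> : (cols n v)^T *m v j.+1 = delta_mx (Ordinal jn) 0.
  apply/matrixP => i c; rewrite ord1 mulmx_trcols mxE dotc_orthogonal_cols //=.
  by rewrite eqSS -val_eqE eqxx andbT.
rewrite -mulmxA -colE mulmx_cols.
have jm : (j < m)%N := leq_trans jn le_nm.
rewrite (bigD1 (Ordinal jm)) //= big1 ?addr0 => [|i].
  by rewrite !mxE /= eqxx.
by rewrite -val_eqE /= => /negbTE ij; rewrite !mxE /= ij scale0r.
Qed.

Lemma svd_mulmx_tr j : (1 <= j <= n)%N -> A^T *m u j = sigma j *: v j.
Proof.
case: j => [|j] //= jn; have [uO _ ->] := svdA; rewrite !trmx_mul trmxK -!mulmxA.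
have jm : (j < m)%N := leq_trans jn le_nm.
have -> : (cols m u)^T *m u j.+1 = delta_mx (Ordinal jm) 0.
  apply/matrixP => i c; rewrite ord1 mulmx_trcols mxE dotc_orthogonal_cols //=.
  by rewrite eqSS -val_eqE eqxx andbT.
rewrite -colE mulmx_cols.
rewrite (bigD1 (Ordinal jn)) //= big1 ?addr0 => [|i].
  by rewrite !mxE /= eqxx.
by rewrite -val_eqE /= eq_sym => /negbTE ij; rewrite !mxE /= ij scale0r.
Qed.

Lemma dotc_svd_gram j w : (1 <= j <= n)%N ->
  dotc (v j) (A^T *m (A *m w)) = sigma j ^+ 2 * dotc (v j) w.
Proof.
move=> jn; rewrite -dotc_mulmxl svd_mulmx // dotcZl dotc_mulmxr.
by rewrite svd_mulmx_tr // dotcZl mulrA.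
Qed.

(** These coordinates are the entries of [D T_k], which connects the Krylov space to [Delta]. *)
Lemma dotc_svd_krylov b j i : (1 <= j <= n)%N ->
  dotc (v j) (iter i (fun w => A^T *m (A *m w)) (A^T *m b))
  = sigma j * dotc (u j) b * sigma j ^+ (2 * i).
Proof.
move=> jn; elim: i => [|i IH] /=.
  by rewrite -dotc_mulmxl svd_mulmx // dotcZl mulr1.
by rewrite dotc_svd_gram // IH mulnS exprD; ring.
Qed.

Lemma norm2_svd x :
  norm2 (A *m x) ^+ 2 = \sum_(i < n) (sigma i.+1 * dotc (v i.+1) x) ^+ 2.
Proof.
have [_ vO _] := svdA; rewrite norm2_sqr dotc_mulmxl (Parseval _ _ vO).
apply: eq_bigr => i _; rewrite dotc_svd_gram ?ltn_ord //; ring.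
Qed.

End SingularVectors.

(** * The matrix Delta_k and the role of epsilon_k *)

Section DeltaBound.
Variables (R : realType) (n : nat) (sigma : nat -> R).
Hypothesis sigmaP : simple_positive n sigma.

Lemma simple_positive_gt0 i : (1 <= i <= n)%N -> 0 < sigma i.
Proof. by case: sigmaP => _; apply. Qed.

Lemma simple_positive_lt i j : (1 <= i < j)%N -> (j <= n)%N -> sigma j < sigma i.
Proof.
case: sigmaP => sd _; elim: j => [|j IH] ij jn; first by lia.
have [->|ineq] := eqVneq i j; first by apply: sd; lia.
by apply: lt_trans (sd j _) (IH _ _); lia.
Qed.

Lemma diag_block_unit (d : nat -> R) k :
  (forall i, (1 <= i <= k)%N -> d i != 0) -> diag_block d 0 k \in unitmx.
Proof.
move=> d0; rewrite unitmxE det_diag unitfE; apply/prodf_neq0 => i _.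
by rewrite mxE d0 //= ltn_ord.
Qed.

(** A transposed Vandermonde matrix whose nodes, the squared singular values, are distinct. *)
Lemma T_block_unit k : (k <= n)%N -> T_block sigma k 0 k \in unitmx.
Proof.
move=> kn; pose a : 'rV[R]_k := \row_j sigma j.+1 ^+ 2.
have -> : T_block sigma k 0 k = (Vandermonde k a)^T.
  by apply/matrixP => i j; rewrite !mxE -exprM.
rewrite unitmx_tr unitmxE det_Vandermonde unitfE.
apply/prodf_neq0 => i _; apply/prodf_neq0 => j ij; rewrite !mxE subr_eq0.
have si : 0 < sigma i.+1 by apply: simple_positive_gt0; have := ltn_ord i; lia.
have sj : 0 < sigma j.+1 by apply: simple_positive_gt0; have := ltn_ord j; lia.
rewrite lt_eqF // ltr_pXn2r ?nnegrE ?(ltW si) ?(ltW sj) //.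
by apply: simple_positive_lt; have := ltn_ord j; lia.
Qed.

Lemma mulmx_T_block (d : nat -> R) k s N (y : 'cV[R]_N) (i : 'I_k) :
  ((diag_block d s N *m T_block sigma k s N)^T *m y) i 0 =
  \sum_(j < N) y j 0 * (d (s + j)%N.+1 * sigma (s + j)%N.+1 ^+ (2 * i)).
Proof.
rewrite mxE; apply: eq_bigr => j _; rewrite mulrC; congr (_ * _).
by rewrite mxE mul_diag_mx !mxE.
Qed.

(** Pairing a kernel vector with itself gives a vanishing sum of two squared norms, one of them its
    own. *)
Lemma gram_unit r s (D : 'M[R]_(r, s)) : 1%:M + D^T *m D \in unitmx.
Proof.
rewrite -row_free_unit -kermx_eq0; apply/eqP/row_matrixP => i; rewrite row0.
set x := row i _; have : x *m (1%:M + D^T *m D) = 0.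
  by rewrite /x -row_mul mulmx_ker row0.
move=> /(congr1 (fun z => dotc z^T x^T)); rewrite trmx0 dotc0l.
rewrite trmx_mul linearD /= trmx1 trmx_mul trmxK mulmxDl mul1mx dotcDl.
rewrite -mulmxA dotc_mulmxl trmxK.
have := dotcc_ge0 (D *m x^T); have := dotcc_ge0 x^T => x0 Dx0 h.
apply: trmx_inj; rewrite trmx0; apply: dotcc_eq0; lra.
Qed.

Variables (m : nat) (u : nat -> 'cV[R]_m) (b : 'cV[R]_m).
Hypothesis ubP : forall i, (1 <= i <= n)%N -> dotc (u i) b != 0.

(* Orthogonality of [y] to the Krylov vectors reads [T_k^T D y = 0], and the
   leading [k x k] block of [D T_k] is invertible. *)
Lemma Delta_krylov k (y1 : 'cV[R]_k) (y2 : 'cV[R]_(n - k)) : (k <= n)%N ->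
  (forall i, (i < k)%N ->
    \sum_(j < k) y1 j 0 * (sigma j.+1 * dotc (u j.+1) b * sigma j.+1 ^+ (2 * i))
    + \sum_(j < n - k) y2 j 0 * (sigma (k + j)%N.+1 * dotc (u (k + j)%N.+1) b
        * sigma (k + j)%N.+1 ^+ (2 * i)) = 0) ->
  y1 = - ((Delta n sigma u b k)^T *m y2).
Proof.
move=> kn h; rewrite /Delta; set d := fun j => sigma j * dotc (u j) b.
set D1 := diag_block d 0 k; set D2 := diag_block d k (n - k).
set T1 := T_block sigma k 0 k; set T2 := T_block sigma k k (n - k).
have D1u : D1 \in unitmx.
  apply: diag_block_unit => i ik; rewrite mulf_neq0 ?ubP //; last by lia.
  by rewrite gt_eqF // simple_positive_gt0 //; lia.
have T1u : T1 \in unitmx by exact: T_block_unit.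
have key : (D1 *m T1)^T *m y1 + (D2 *m T2)^T *m y2 = 0.
  apply/matrixP => i c; rewrite ord1 [LHS]mxE !mulmx_T_block [RHS]mxE.
  exact: h.
(* [Delta] is [D2 T2] times the inverse of [D1 T1]; its transpose is exactly what solving [key] for
   [y1] produces. *)
have -> : (D2 *m T2 *m invmx T1 *m invmx D1)^T *m y2
    = invmx (D1 *m T1)^T *m ((D2 *m T2)^T *m y2).
  rewrite -mulmxA [in LHS]trmx_mul -mulmxA; congr (_ *m _).
  apply: (can_inj (mulmxK (_ : (D1 *m T1)^T \in unitmx))).
    by rewrite unitmx_tr unitmx_mul D1u T1u.
  rewrite mulVmx ?unitmx_tr ?unitmx_mul ?D1u //.
  by rewrite -trmx_mul mulmxA (mulmxK T1u) ?mulmxV ?trmx1.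
apply: (can_inj (mulKmx (_ : (D1 *m T1)^T \in unitmx))).
  by rewrite unitmx_tr unitmx_mul D1u T1u.
rewrite mulmxN mulKVmx ?unitmx_tr ?unitmx_mul ?D1u //.
by apply/eqP; rewrite -addr_eq0 key.
Qed.

(* With [W = (I + Delta^T Delta)^-1], the relation [y1 = - Delta^T y2] gives
   [y1 = W Delta^T Delta y1 - W Delta^T y2]. *)
Lemma epsilonk_bound k (y1 : 'cV[R]_k) (y2 : 'cV[R]_(n - k)) :
  y1 = - ((Delta n sigma u b k)^T *m y2) ->
  norm2 (diag_block sigma 0 k *m y1) ^+ 2
    <= epsilonk n sigma u b k ^+ 2 * (norm2 y1 ^+ 2 + norm2 y2 ^+ 2).
Proof.
rewrite /epsilonk; move: (Delta _ _ _ _ _) => D; set S := diag_block _ _ _.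
set W := invmx _ => y1E.
(* Multiplied by [I + D^T D], this is the hypothesis with [D^T D y1] added to both sides. *)
have y1W : y1 = W *m D^T *m D *m y1 - W *m D^T *m y2.
  apply: (can_inj (mulKmx (gram_unit D))).
  rewrite mulmxBr -!mulmxA !mulKVmx ?gram_unit // mulmxDl mul1mx.
  by rewrite -mulmxA [X in X + _]y1E addrC.
rewrite [X in _ <= X * _]sqr_sqrtr ?addr_ge0 ?sqr_ge0 //.
set s1 := specnorm _; set s2 := specnorm _.
have Sy : norm2 (S *m y1) <= s1 * norm2 y1 + s2 * norm2 y2.
  rewrite [in leLHS]y1W mulmxBr !mulmxA; apply: le_trans (ler_norm2D _ _) _.
  by rewrite norm2N lerD // norm2_mulmx_le.
apply: (@le_trans _ _ ((s1 * norm2 y1 + s2 * norm2 y2) ^+ 2)).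
  by rewrite ler_pXn2r ?nnegrE ?norm2_ge0 // (le_trans (norm2_ge0 _) Sy).
(* Cauchy-Schwarz in the plane, through Lagrange's identity. *)
rewrite -subr_ge0.
have -> : (s1 ^+ 2 + s2 ^+ 2) * (norm2 y1 ^+ 2 + norm2 y2 ^+ 2)
    - (s1 * norm2 y1 + s2 * norm2 y2) ^+ 2
  = (s1 * norm2 y2 - s2 * norm2 y1) ^+ 2 by ring.
exact: sqr_ge0.
Qed.

End DeltaBound.

(** * The upper bound on gamma_k and the final inequalities *)

Lemma sum_ord_split (V : nmodType) (F : nat -> V) k n : (k <= n)%N ->
  \sum_(i < n) F i = \sum_(i < k) F i + \sum_(i < n - k) F (k + i)%N.
Proof. by move=> kn; rewrite -[in LHS](subnKC kn) big_split_ord. Qed.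

Lemma gammak_upper (R : realType) (m n : nat) (A : 'M[R]_(m, n)) (b : 'cV[R]_m)
    (u : nat -> 'cV[R]_m) (sigma : nat -> R) (v : nat -> 'cV[R]_n)
    (alpha beta : nat -> R) (p : nat -> 'cV[R]_m) (q : nat -> 'cV[R]_n) k :
  (n <= m)%N -> is_svd A u sigma v -> simple_positive n sigma ->
  (forall i, (1 <= i <= n)%N -> dotc (u i) b != 0) ->
  lanczos_bidiag A b alpha beta p q -> (k < n)%N ->
  gammak A alpha beta p q k
    <= Num.sqrt (1 + etak n sigma u b k ^+ 2) * sigma k.+1.
Proof.
move=> le_nm svdA sigmaP ubP lan kn; have [_ vO _] := svdA.
have sk : 0 < sigma k.+1 by apply: (simple_positive_gt0 sigmaP); lia.
set c := Num.sqrt _ * _; set eps := epsilonk n sigma u b k.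
have c0 : 0 <= c by rewrite mulr_ge0 ?sqrtr_ge0 // ltW.
have c2 : c ^+ 2 = sigma k.+1 ^+ 2 + eps ^+ 2.
  rewrite exprMn sqr_sqrtr ?addr_ge0 ?sqr_ge0 // /etak -/eps; field.
  by rewrite gt_eqF.
apply: (gammak_le lan) => [||y y0] //; first exact: ltnW.
pose y1 : 'cV[R]_k := \col_i dotc (v i.+1) y.
pose y2 : 'cV[R]_(n - k) := \col_i dotc (v (k + i)%N.+1) y.
have y1E : y1 = - ((Delta n sigma u b k)^T *m y2).
  apply: (Delta_krylov sigmaP ubP) => [|i ik]; first exact: ltnW.
  rewrite -[RHS](lanczos_krylov_orthogonal lan (ltnW kn) ik y0) (Parseval _ _ vO).
  set w := iter i _ _.
  rewrite (sum_ord_split (fun j => dotc (v j.+1) y * dotc (v j.+1) w) (ltnW kn)).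
  congr (_ + _); apply: eq_bigr => j _; rewrite mxE (dotc_svd_krylov le_nm svdA) //.
    by have := ltn_ord j; lia.
  by have := ltn_ord j; lia.
have yE : norm2 y ^+ 2 = norm2 y1 ^+ 2 + norm2 y2 ^+ 2.
  rewrite !norm2_sqr (Parseval _ _ vO).
  rewrite (sum_ord_split (fun j => dotc (v j.+1) y * dotc (v j.+1) y) (ltnW kn)).
  by rewrite !dotcE; congr (_ + _); apply: eq_bigr => j _; rewrite !mxE.
have Sy1 : norm2 (diag_block sigma 0 k *m y1) ^+ 2
    = \sum_(i < k) (sigma i.+1 * dotc (v i.+1) y) ^+ 2.
  by rewrite norm2_sqr dotcE; apply: eq_bigr => i _; rewrite mul_diag_mx !mxE.
(* The singular values decrease, so [sigma k.+1] dominates the whole tail. *)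
have tail : \sum_(i < n - k) (sigma (k + i)%N.+1 * dotc (v (k + i)%N.+1) y) ^+ 2
    <= sigma k.+1 ^+ 2 * norm2 y2 ^+ 2.
  rewrite norm2_sqr dotcE mulr_sumr; apply: ler_sum => i _.
  rewrite !mxE -expr2 exprMn ler_wpM2r ?sqr_ge0 //.
  have si : 0 < sigma (k + i)%N.+1.
    by apply: (simple_positive_gt0 sigmaP); have := ltn_ord i; lia.
  rewrite ler_pXn2r ?nnegrE ?(ltW sk) ?(ltW si) //.
  have [->|i0] := eqVneq (i : nat) 0%N; first by rewrite addn0.
  by apply/ltW/(simple_positive_lt sigmaP); have := ltn_ord i; lia.
rewrite -(@ler_pXn2r _ 2) ?nnegrE ?(mulr_ge0 c0 (norm2_ge0 y)) ?norm2_ge0 // exprMn c2.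
rewrite (norm2_svd le_nm svdA).
rewrite (sum_ord_split (fun j => (sigma j.+1 * dotc (v j.+1) y) ^+ 2) (ltnW kn)).
(* The tail accounts for the [sigma k.+1 ^+ 2] part of [c ^+ 2], the leading coordinates for the
   [eps ^+ 2] part. *)
rewrite -Sy1 [leRHS]mulrDl addrC lerD //.
  apply: le_trans tail _; apply: ler_wpM2l; first exact: sqr_ge0.
  by rewrite yE lerDr sqr_ge0.
by rewrite yE; exact: epsilonk_bound.
Qed.

Theorem theorem5p1 (R : realType) (m n : nat) (A : 'M[R]_(m, n)) (b : 'cV[R]_m)
    (u : nat -> 'cV[R]_m) (sigma : nat -> R) (v : nat -> 'cV[R]_n)
    (alpha beta : nat -> R) (p : nat -> 'cV[R]_m) (q : nat -> 'cV[R]_n)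
    (le_nm : (n <= m)%N)
    (svdA : is_svd A u sigma v)
    (sigmaP : simple_positive n sigma)
    (ubP : forall i, (1 <= i <= n)%N -> dotc (u i) b != 0)
    (lanczosP : lanczos_bidiag A b alpha beta p q) :
  let gam := gammak A alpha beta p q in
  let et := etak n sigma u b in
  [/\ forall k, (1 <= k <= n - 1)%N ->
        alpha k.+1 < gam k /\ gam k <= Num.sqrt (1 + et k ^+ 2) * sigma k.+1,
      forall k, (1 <= k <= n - 1)%N ->
        beta k.+2 < gam k /\ gam k <= Num.sqrt (1 + et k ^+ 2) * sigma k.+1,
      forall k, (1 <= k <= n - 1)%N ->
        alpha k.+1 * beta k.+2 <= gam k ^+ 2 / 2
        /\ gam k ^+ 2 / 2 <= (1 + et k ^+ 2) * sigma k.+1 ^+ 2 / 2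
    & forall k, (1 <= k <= n - 2)%N -> gam k.+1 < gam k].
Proof.
move=> gam et.
have lower k : (1 <= k <= n - 1)%N ->
    alpha k.+1 ^+ 2 + beta k.+2 ^+ 2 <= gam k ^+ 2.
  by move=> kn; apply: (gammak_lower lanczosP); lia.
have upper k : (1 <= k <= n - 1)%N ->
    gam k <= Num.sqrt (1 + et k ^+ 2) * sigma k.+1.
  by move=> kn; apply: (gammak_upper le_nm svdA) => //; lia.
have alpha0 k : (1 <= k <= n - 1)%N -> 0 < alpha k.+1.
  by move=> kn; apply: (lanczos_alpha_gt0 lanczosP); lia.
have beta0 k : (1 <= k <= n - 1)%N -> 0 < beta k.+2.
  by move=> kn; apply: (lanczos_beta_gt0 lanczosP); lia.
have gam0 k : 0 <= gam k by exact: specnorm_ge0.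
split=> k kn.
- split; last exact: upper.
  rewrite -(@ltr_pXn2r _ 2) ?nnegrE ?gam0 ?(ltW (alpha0 k kn)) //.
  (* Strictness comes from the other, positive, square in [lower]. *)
  by apply: lt_le_trans (lower k kn); rewrite ltrDl exprn_gt0 ?beta0.
- split; last exact: upper.
  rewrite -(@ltr_pXn2r _ 2) ?nnegrE ?gam0 ?(ltW (beta0 k kn)) //.
  by apply: lt_le_trans (lower k kn); rewrite ltrDr exprn_gt0 ?alpha0.
- split.
    (* Arithmetic-geometric mean inequality for the two squares. *)
    have := lower k kn; have := sqr_ge0 (alpha k.+1 - beta k.+2).
    rewrite sqrrB; lra.
  have s0 : 0 < sigma k.+1 by apply: (simple_positive_gt0 sigmaP); lia.
  rewrite ler_pM2r ?invr_gt0 //.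
  have -> : (1 + et k ^+ 2) * sigma k.+1 ^+ 2
      = (Num.sqrt (1 + et k ^+ 2) * sigma k.+1) ^+ 2.
    by rewrite [RHS]exprMn sqr_sqrtr ?addr_ge0 ?sqr_ge0.
  by rewrite ler_pXn2r ?nnegrE ?upper // mulr_ge0 ?sqrtr_ge0 ?ltW.
- by apply: (gammak_strict lanczosP); lia.
Qed.
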